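(* There is an absolute constant $c'$ such that the following holds. Let $I=[a,b]\subset\mathbb{Z}$ be an interval of integers with $a<b$, and put $B=b-a$. Let $f_0:\mathbb{Z}\to\mathbb{N}$ be a starting configuration (a map with finite support contained in $2\mathbb{Z}$ or in $2\mathbb{Z}+1$), let $g_0=f_0$, and let $(f_t)_{t\ge0}$ and $(g_t)_{t\ge0}$ be the evolutions of the liar machine started from $f_0$ and of the linear machine started from $g_0$, respectively. Then for every integer $t\ge 0$, $$|f_t(I)-g_t(I)|\le c'\cdot\begin{cases}\sqrt{t} & \text{if } B>\sqrt{t}/2,\\ B\log(t/B^2) & \text{if } B\le\sqrt{t}/2.\end{cases}$$
   Context: $\mathbb{N}=\{0,1,2,\dots\}$; $\log$ is the natural logarithm. For $h:\mathbb{Z}\to\mathbb{R}$ and $S\subset\mathbb{Z}$, $h(S)=\sum_{i\in S}h(i)$. The interval $[a,b]$ denotes $\{a,a+1,\dots,b\}$. Liar machine: given $f_t:\mathbb{Z}\to\mathbb{N}$ with finite support, define $\chi_t:\mathbb{Z}\to\{-1,0,1\}$ by $\chi_t(j)=0$ if $f_t(j)$ is even and $\chi_t(j)=(-1)^{\sum_{i<j}\chi_t(i)}$ if $f_t(j)$ is odd. Then $$f_{t+1}(j)=\frac{f_t(j-1)+f_t(j+1)+\chi_t(j-1)-\chi_t(j+1)}{2}.$$ Linear machine: given $g_t:\mathbb{Z}\to\mathbb{R}$, define $g_{t+1}(j)=\frac{g_t(j-1)+g_t(j+1)}{2}$. *)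

(* Defs.v *)
From HB Require Import structures.
From mathcomp Require Import all_boot all_order all_algebra.
From mathcomp Require Import all_classical all_reals all_analysis.

Set Implicit Arguments.
Unset Strict Implicit.
Unset Printing Implicit Defensive.

Import Order.TTheory GRing.Theory Num.Theory.

Local Open Scope classical_set_scope.
Local Open Scope ring_scope.

Definition starting_configuration (f : int -> nat) : Prop :=
  let supp := [set j | f j <> 0%N] in
  finite_set supp /\
  (supp `<=` [set 2 * k | k in [set: int]] \/
   supp `<=` [set 2 * k + 1 | k in [set: int]]).

(* The defining equation of the sign pattern chi of a configuration f; it
   determines chi uniquely when f has finite support (recursion from the left
   end of the support).  The sum over ]-oo, j[ is the sum of the nonzero terms,
   which are finitely many since chi vanishes wherever f is even; the exponent
   is an integer, hence the integer power [^]. *)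
Definition is_chi (f : int -> nat) (chi : int -> int) : Prop :=
  forall j : int,
    chi j = if odd (f j) then (-1) ^ (\sum_(i \in `]-oo, j[) chi i) else 0.

(* The halved quantity is always an even natural number, so the halving is
   written, without truncation, as an equation for twice the new value. *)
Definition liar_step (f f' : int -> nat) : Prop :=
  exists2 chi : int -> int, is_chi f chi &
    forall j : int,
      2 * (f' j)%:Z =
        (f (j - 1))%:Z + (f (j + 1))%:Z + chi (j - 1) - chi (j + 1).

Definition liar_evolution (f : nat -> int -> nat) : Prop :=
  forall t : nat, liar_step (f t) (f t.+1).

Definition linear_evolution (R : realType) (g : nat -> int -> R) : Prop :=
  forall (t : nat) (j : int), g t.+1 j = (g t (j - 1) + g t (j + 1)) / 2.

Definition config_sum (R : realType) (h : int -> R) (S : set int) : R :=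
  \sum_(i \in S) h i.

(* Main.v *)
Require Import Defs.
From HB Require Import structures.
From mathcomp Require Import all_boot all_order all_algebra.
From mathcomp Require Import all_classical all_reals all_analysis.
From mathcomp Require Import zify ring lra.

Set Implicit Arguments.
Unset Strict Implicit.
Unset Printing Implicit Defensive.

Import Order.TTheory GRing.Theory Num.Theory.

Local Open Scope classical_set_scope.
Local Open Scope ring_scope.

(** The discrepancy d_t = f_t - g_t obeys d_(t+1) = A d_t - D chi_t, where
    A h (j) = (h(j-1) + h(j+1)) / 2 is one step of the simple random walk
    ([avg]) and D h (j) = (h(j+1) - h(j-1)) / 2 the central difference
    ([cdiff]).  The signs of chi_t alternate along Z and start with +1, so the
    sums of chi_t over initial segments only take the values 0 and 1; and as
    chi_t lives on a single parity class, it is itself a central difference,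
    chi_t = 2 D S_t with 0 <= S_t <= 1 ([chi_primitive]).  Hence
      d_t = - 2 * sum_(u < t) A^u D^2 S_(t-1-u)    ([forced_walk]),
    and only the smoothing effect of the random walk on bounded functions
    matters.

    That effect comes from a discrete Stein identity
      E[X_n h(X_n)] = n E[(D h)(X_(n-1))]          ([iter_avg_stein])
    for the walk X started at 0.  Taking h(x) = x it gives E[X_n^2] = n; together
    with E|X_n| <= sqrt n it gives |A^u D h| <= sup|h| / sqrt(u+1)
    ([norm_cdiff_iter_avg]).  Splitting the u steps into two halves, one for
    each D, yields |A^u D^2 h| <= 2 sup|h| / (u+1).

    Over an interval of B+1 points, A^u D^2 S therefore sums to at most
    2(B+1)/(u+1); it also telescopes to four values of A^u D S, which gives
    2/sqrt(u+1).  Summing the second bound over u < t gives O(sqrt t).  For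
    B <= sqrt t / 2, use the second bound for u < B^2, total O(B), and the first
    for B^2 <= u < t, total O(B log(t/B^2)); the logarithm is then at least
    log 4, so it absorbs the O(B). *)

(** * Smoothing by the simple random walk *)

Section RandomWalk.
Variable R : realType.
Implicit Types (h k : int -> R) (j : int) (n u : nat) (K : R).

Definition avg h j : R := (h (j - 1) + h (j + 1)) / 2.

Definition cdiff h j : R := (h (j + 1) - h (j - 1)) / 2.

Lemma iter_avgD n h k j :
  iter n avg (fun x => h x + k x) j = iter n avg h j + iter n avg k j.
Proof.
elim: n j => [//|n IHn] j; rewrite !iterS {1}/avg !IHn /avg; lra.
Qed.

Lemma iter_avgZ n c h j :
  iter n avg (fun x => c * h x) j = c * iter n avg h j.
Proof.
elim: n j => [//|n IHn] j; rewrite !iterS {1}/avg !IHn /avg; lra.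
Qed.

Lemma iter_avg_cst n c j : iter n avg (fun=> c) j = c.
Proof. by elim: n j => [//|n IHn] j; rewrite iterS /avg !IHn; lra. Qed.

Lemma ler_norm_iter_avg n h k j :
  (forall x, `|h x| <= k x) -> `|iter n avg h j| <= iter n avg k j.
Proof.
move=> le_hk; elim: n j => [//|n IHn] j; rewrite !iterS /avg.
have := IHn (j - 1); have := IHn (j + 1); rewrite !ler_norml; lra.
Qed.

Lemma cdiff_avg h j : cdiff (avg h) j = avg (cdiff h) j.
Proof. by rewrite /cdiff /avg !addrK ?subrK; lra. Qed.

Lemma cdiff_iter_avg n h j : cdiff (iter n avg h) j = iter n avg (cdiff h) j.
Proof.
by elim: n j => [//|n IHn] j; rewrite !iterS cdiff_avg /avg !IHn.
Qed.

(** Discrete integration by parts for the walk started at [j]: one step turns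
    (x - j) h into (x - j) (A h) + D h, and A commutes with D, so each of the n
    steps releases one copy of A^(n-1) D h. *)
Lemma iter_avg_stein n h j :
  iter n avg (fun x => (x - j)%:~R * h x) j
  = n%:R * iter n.-1 avg (cdiff h) j.
Proof.
elim: n h => [|n IHn] h; first by rewrite /= subrr !mul0r.
rewrite iterSr.
have -> : avg (fun x => (x - j)%:~R * h x)
        = fun x => (x - j)%:~R * avg h x + cdiff h x.
  by apply/funext => x; rewrite /avg /cdiff !rmorphB !rmorphD /=; field.
rewrite iter_avgD IHn /=.
have -> : cdiff (avg h) = avg (cdiff h) by apply/funext => x; exact: cdiff_avg.
case: n {IHn} => [|n]; first by rewrite mul0r add0r mul1r.
by rewrite /= -iterSr iterS -[n.+2%:R]natr1 mulrDl mul1r.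
Qed.

Lemma iter_avg_variance n j :
  iter n avg (fun x => (x - j)%:~R ^+ 2) j = n%:R.
Proof.
under [X in iter _ _ X]eq_fun do rewrite expr2.
rewrite iter_avg_stein.
have -> : cdiff (fun x => (x - j)%:~R) = fun=> 1.
  by apply/funext => x; rewrite /cdiff !rmorphB !rmorphD /=; field.
by rewrite iter_avg_cst mulr1.
Qed.

(** By [iter_avg_stein] with n = u+1, A^u D h (j) is the average of
    (x - j) h(x) over the n-step walk, divided by n; and the walk moves by at
    most sqrt n on average since its variance is n. *)
Lemma norm_cdiff_iter_avg u h K j : (forall x, `|h x| <= K) ->
  `|iter u avg (cdiff h) j| <= K / Num.sqrt u.+1%:R.
Proof.
move=> hK.
have K_ge0 : 0 <= K by apply: le_trans (hK 0).
set r := Num.sqrt _.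
have r_gt0 : 0 < r by rewrite sqrtr_gt0 ltr0n.
have r2 : r ^+ 2 = u.+1%:R by rewrite sqr_sqrtr // ler0n.
(* The inequality y <= (y^2 / r + r) / 2 between |x - j| and its square avoids
   Cauchy-Schwarz; r = sqrt n balances the two terms after averaging. *)
have /(ler_norm_iter_avg u.+1 j) :
    forall x, `|(x - j)%:~R * h x| <= (K / (2 * r)) * (x - j)%:~R ^+ 2 + K * r / 2.
  move=> x; rewrite normrM -(real_normK (num_real (x - j)%:~R)); set y := `|_%:~R|.
  have y_ge0 : 0 <= y by exact: normr_ge0.
  apply: (@le_trans _ _ (y * K)); first by rewrite ler_wpM2l.
  have -> : K / (2 * r) * y ^+ 2 + K * r / 2
          = y * K + K / (2 * r) * (y - r) ^+ 2.
    by field; rewrite gt_eqF.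
  by rewrite lerDl mulr_ge0 ?sqr_ge0 // divr_ge0 // mulr_ge0 // ltW.
rewrite iter_avgD iter_avgZ iter_avg_cst iter_avg_variance iter_avg_stein /=.
rewrite normrM normr_nat -r2 => le_r.
have : r ^+ 2 * `|iter u avg (cdiff h) j| <= r ^+ 2 * (K / r).
  apply: le_trans le_r _; rewrite le_eqVlt; apply/orP; left.
  by apply/eqP; field; rewrite gt_eqF.
by rewrite ler_pM2l // exprn_gt0.
Qed.

End RandomWalk.

Arguments avg {R}.
Arguments cdiff {R}.

(** * Error terms and their sums *)

Section ErrorBounds.
Variable R : realType.
Implicit Types (h : int -> R) (a j : int) (n u t : nat) (K : R).

(** A commutes with D, so each half of the u steps can smooth one of the two
    differences, with a gain of a factor about sqrt(u/2) each time. *)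
Lemma norm_cdiff2_iter_avg u h K j : (forall x, `|h x| <= K) ->
  `|iter u avg (cdiff (cdiff h)) j| <= 2 * K / u.+1%:R.
Proof.
move=> hK.
have K_ge0 : 0 <= K by apply: le_trans (hK 0).
pose p := u./2; pose q := uphalf u.
have upq : u = (p + q)%N by rewrite /p /q; lia.
rewrite {1}upq iterD.
have -> : iter q avg (cdiff (cdiff h)) = cdiff (iter q avg (cdiff h)).
  by apply/funext => x; rewrite cdiff_iter_avg.
apply: le_trans (norm_cdiff_iter_avg p j _) _.
  by move=> x; exact: (norm_cdiff_iter_avg q x hK).
(* Both halves, increased by one, are at least (u+1)/2. *)
set z : R := Num.sqrt (u.+1%:R / 2).
have z2 : z ^+ 2 = u.+1%:R / 2 by rewrite sqr_sqrtr // divr_ge0.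
have z_gt0 : 0 < z by rewrite sqrtr_gt0 divr_gt0 // ltr0n.
have inv_le m : (u.+1 <= 2 * m)%N -> (Num.sqrt m%:R)^-1 <= z^-1.
  move=> le_um; have m_gt0 : (0 < m)%N by lia.
  rewrite lef_pV2 ?posrE ?sqrtr_gt0 ?ltr0n // ler_wsqrtr //.
  by rewrite ler_pdivrMr // -natrM ler_nat mulnC.
have -> : 2 * K / u.+1%:R = K / z / z.
  have -> : u.+1%:R = 2 * z ^+ 2 by rewrite z2; field.
  by field; rewrite gt_eqF.
apply: ler_pM; rewrite ?invr_ge0 ?sqrtr_ge0 ?mulr_ge0 ?invr_ge0 ?sqrtr_ge0 //.
  by apply: ler_wpM2l => //; apply: inv_le; rewrite /q; lia.
by apply: inv_le; rewrite /p; lia.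
Qed.

Lemma sum_cdiff h a n :
  \sum_(i < n.+1) cdiff h (a + i%:Z)
  = (h (a + n%:Z + 1) + h (a + n%:Z) - h a - h (a - 1)) / 2.
Proof.
elim: n => [|n IHn].
  by rewrite big_ord_recr big_ord0 /= addr0 add0r /cdiff; lra.
rewrite big_ord_recr /= IHn /cdiff -[n.+1]addn1 PoszD addrA addrK; lra.
Qed.

Lemma norm_sum_cdiff2_telescope u h K a n : (forall x, `|h x| <= K) ->
  `|\sum_(i < n.+1) iter u avg (cdiff (cdiff h)) (a + i%:Z)|
  <= 2 * K / Num.sqrt u.+1%:R.
Proof.
move=> hK.
under eq_bigr do rewrite -cdiff_iter_avg.
rewrite sum_cdiff -mulrA.
have B := norm_cdiff_iter_avg u _ hK; move: (K / _) B => c B.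
have := B a; have := B (a - 1); have := B (a + n%:Z); have := B (a + n%:Z + 1).
rewrite !ler_norml; lra.
Qed.

Lemma norm_sum_cdiff2_count h u K a n :
  (forall x, `|h x| <= K) ->
  `|\sum_(i < n.+1) iter u avg (cdiff (cdiff h)) (a + i%:Z)|
  <= n.+1%:R * (2 * K / u.+1%:R).
Proof.
move=> hK; apply: le_trans (ler_norm_sum _ _ _) _.
apply: (@le_trans _ _ (\sum_(i < n.+1) 2 * K / u.+1%:R)).
  by apply: ler_sum => i _; exact: norm_cdiff2_iter_avg.
by rewrite sumr_const card_ord [leRHS]mulr_natl.
Qed.

(** Duhamel's formula: the source term injected at time t-1-u has been averaged
    u times at time t. *)
Lemma forced_walk (d S : nat -> int -> R) t j :
  (forall x, d 0%N x = 0) ->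
  (forall s x, d s.+1 x = avg (d s) x - 2 * cdiff (cdiff (S s)) x) ->
  d t j = - 2 * \sum_(u < t) iter u avg (cdiff (cdiff (S (t - u.+1)%N))) j.
Proof.
move=> d0 dS; elim: t j => [|t IHt] j; first by rewrite d0 big_ord0 mulr0.
rewrite dS big_ord_recl /= subSS subn0.
under eq_bigr do rewrite add0n /bump leq0n add1n subSS.
rewrite /avg !IHt -mulr_suml big_split /=; lra.
Qed.

Lemma sum_invsqrt_le t :
  \sum_(u < t) (Num.sqrt u.+1%:R)^-1 <= 2 * Num.sqrt t%:R :> R.
Proof.
elim: t => [|t IHt]; first by rewrite big_ord0 sqrtr0 mulr0.
rewrite big_ord_recr /=.
set y := Num.sqrt t.+1%:R; set x := Num.sqrt t%:R in IHt *.
have y0 : 0 < y by rewrite sqrtr_gt0 ltr0n.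
have y2 : y ^+ 2 = x ^+ 2 + 1 by rewrite !sqr_sqrtr ?ler0n // natr1.
suff : y^-1 <= 2 * (y - x) by lra.
by rewrite -div1r ler_pdivrMr //; nra.
Qed.

Lemma ln_ge1BV (x : R) : 0 < x -> 1 - x^-1 <= ln x.
Proof.
move=> x0; have xV0 : 0 < x^-1 by rewrite invr_gt0.
have := @le_ln1Dx R (x^-1 - 1).
rewrite (addrC 1) subrK lnV ?posrE //.
have hx : -1 < x^-1 - 1 by lra.
by move=> /(_ hx); lra.
Qed.

Lemma sum_inv_le_ln m t : (0 < m <= t)%N ->
  \sum_(m <= u < t) u.+1%:R^-1 <= ln (t%:R / m%:R) :> R.
Proof.
move=> /andP[m0]; elim: t => [|t IHt]; first by rewrite leqn0; lia.
rewrite leq_eqVlt => /orP[/eqP <-|]; last rewrite ltnS => mt.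
  by rewrite big_geq // divff ?ln1 // pnatr_eq0; lia.
have t0 : (0 < t)%N by lia.
rewrite big_nat_recr //=; have := IHt mt.
have mR : (0 : R) < m%:R by rewrite ltr0n.
have tR : (0 : R) < t%:R by rewrite ltr0n.
have tR1 : (0 : R) < t.+1%:R by rewrite ltr0n.
have := @ln_ge1BV (t.+1%:R / t%:R) (divr_gt0 tR1 tR).
rewrite !ln_div ?posrE // invf_div.
have -> : 1 - t%:R / t.+1%:R = t.+1%:R^-1 :> R.
  by rewrite -natr1; field; rewrite natr1 gt_eqF.
move=> h1 h2; apply: le_trans (lerD h2 h1) _.
by rewrite addrC addrA subrK.
Qed.

(** The two bounds on [e] cross at about u = n^2, whence the splitting point. *)
Lemma sum_two_regimes (e : nat -> R) n t : (0 < n)%N -> (4 * n ^ 2 <= t)%N ->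
  (forall u, e u <= 2 / Num.sqrt u.+1%:R) ->
  (forall u, e u <= 4 * n%:R / u.+1%:R) ->
  \sum_(u < t) e u <= 10 * n%:R * ln (t%:R / n%:R ^+ 2).
Proof.
move=> n_gt0 le_nt e_sqrt e_inv.
have nR : 1 <= n%:R :> R by rewrite ler1n.
have le_n2t : (n ^ 2 <= t)%N by lia.
rewrite -(big_mkord xpredT e) (big_cat_nat (n := (n ^ 2)%N)) //=.
have early : \sum_(0 <= u < n ^ 2) e u <= 4 * n%:R.
  apply: (@le_trans _ _ (\sum_(0 <= u < n ^ 2) 2 * (Num.sqrt u.+1%:R)^-1)).
    by apply: ler_sum => u _.
  rewrite -mulr_sumr big_mkord; have := sum_invsqrt_le (n ^ 2).
  by rewrite natrX sqrtr_sqr ger0_norm //; lra.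
have late : \sum_(n ^ 2 <= u < t) e u <= 4 * n%:R * ln (t%:R / n%:R ^+ 2).
  apply: (@le_trans _ _ (\sum_(n ^ 2 <= u < t) 4 * n%:R * u.+1%:R^-1)).
    by apply: ler_sum => u _.
  rewrite -mulr_sumr ler_wpM2l ?mulr_ge0 //.
  by rewrite -natrX sum_inv_le_ln // le_n2t expn_gt0 n_gt0.
(* The early terms are absorbed by the logarithm: 4 n <= (16/3) n ln(t/n^2), and
   16/3 + 4 <= 10. *)
have ln_large : 3 / 4 <= ln (t%:R / n%:R ^+ 2) :> R.
  have n2R : 0 < n%:R ^+ 2 :> R by rewrite exprn_gt0 // ltr0n.
  have tR : 4 * n%:R ^+ 2 <= t%:R :> R by rewrite -natrX -natrM ler_nat.
  apply: le_trans (ln_ge1BV _); last by rewrite divr_gt0 //; lra.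
  rewrite invf_div lerBrDl -lerBrDr ler_pdivrMr; lra.
move: early late; set x := ln _ in ln_large *; nra.
Qed.

End ErrorBounds.

(** * The sign pattern as a central difference *)

Section SignPattern.

Lemma fsum_below (chi : int -> int) (L : int) (n : nat) :
  (forall i, i < L -> chi i = 0) ->
  \sum_(i \in `]-oo, (L + n%:Z)[) chi i = \sum_(i < n) chi (L + i%:Z).
Proof.
move=> chi0.
have injL : injective (fun i : nat => L + i%:Z) by move=> x y; lia.
rewrite (fsbigE [seq L + i%:Z | i <- iota 0 n]) /=; last 3 first.
- by rewrite map_inj_uniq // iota_uniq.
- by move=> _ /= /mapP[i + ->]; rewrite mem_iota in_itv /=; lia.
- move=> i; rewrite in_itv /= => lt_i; apply: contraNeq => chi_i.
  apply/mapP; exists (absz (i - L)); last first.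
    by case: (ltP i L) => [/chi0 /eqP|]; [rewrite (negPf chi_i)|lia].
  rewrite mem_iota; case: (ltP i L) => [/chi0 /eqP|]; last lia.
  by rewrite (negPf chi_i).
have -> : iota 0 n = index_iota 0 n by rewrite /index_iota subn0.
rewrite big_map big_mkcond /= big_mkord.
apply: eq_bigr => i _; rewrite ifT // inE /= in_itv /=; have := ltn_ord i; lia.
Qed.

Lemma chi_zero (f : int -> nat) (chi : int -> int) (j : int) :
  is_chi f chi -> f j = 0%N -> chi j = 0.
Proof. by move=> -> ->. Qed.

(** The prefix sum starts from 0 and changes only where f is odd; there, the sign
    rule takes it from 0 up to 1 and from 1 down to 0. *)
Lemma chi_prefix_sum (f : int -> nat) (chi : int -> int) (L : int) :
  (forall j, j < L -> f j = 0%N) -> is_chi f chi ->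
  exists S : int -> int, (forall j, 0 <= S j <= 1) /\
    (forall j, S (j + 1) = S j + chi j).
Proof.
move=> f0 chiP.
have chi0 i : i < L -> chi i = 0 by move=> /f0; exact: chi_zero.
pose S j := \sum_(i \in `]-oo, j[) chi i; exists S.
have chiS j : chi j = if odd (f j) then (-1) ^ S j else 0 by exact: chiP.
have S0 j : j <= L -> S j = 0.
  by move=> jL; apply: fsbig1 => i /=; rewrite in_itv /= => ij; apply: chi0; lia.
have SL n : S (L + n.+1%:Z) = S (L + n%:Z) + chi (L + n%:Z).
  by rewrite /S !fsum_below // big_ord_recr.
have from_L j : L <= j -> j = L + (absz (j - L))%:Z by lia.
split=> j.
  case: (leP j L) => [/S0 -> //|/ltW /from_L ->].
  elim: (absz _) => [|n]; first by rewrite S0 // addr0.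
  rewrite SL chiS => IHn.
  have [->|->] : S (L + n%:Z) = 0 \/ S (L + n%:Z) = 1 by lia.
    by case: ifP.
  by case: ifP.
case: (ltP j L) => [jL|/from_L ->].
  by rewrite !S0 ?chi0 //; lia.
by rewrite -SL -addn1 PoszD addrA.
Qed.

(** On the class of parity opposite to the support, consecutive prefix sums
    S(j-1) and S(j+1) differ by chi(j-1) + chi(j) = chi(j); setting the primitive
    to 0 on the class of the support makes it right at all j. *)
Lemma chi_primitive (R : realType) (f : int -> nat) (chi : int -> int)
    (L : int) (p : bool) :
  (forall j, j < L -> f j = 0%N) ->
  (forall j, f j <> 0%N -> (2 %| j)%Z = p) ->
  is_chi f chi ->
  exists S : int -> R, (forall j, `|S j| <= 1) /\
    (forall j, (chi j)%:~R = 2 * cdiff S j).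
Proof.
move=> f0 fp chiP; have [S [S01 SS]] := chi_prefix_sum f0 chiP.
exists (fun j => if (2 %| j)%Z == p then 0 else (S j)%:~R).
have chip j : (2 %| j)%Z != p -> chi j = 0.
  by move=> jp; apply: (chi_zero chiP); apply: contraNeq jp => /eqP/fp ->.
split=> j.
  case: ifP => _; first by rewrite normr0.
  by have /andP[S0 S1] := S01 j; rewrite ger0_norm ?ler0z ?lerz1.
rewrite /cdiff.
have -> : (2 %| j + 1)%Z = ~~ (2 %| j)%Z by lia.
have -> : (2 %| j - 1)%Z = ~~ (2 %| j)%Z by lia.
case: (eqVneq (2 %| j)%Z p) => [jp|jp].
  have -> : (~~ (2 %| j)%Z == p) = false by rewrite jp; case: (p).
  have chi1 : chi (j - 1) = 0.
    apply: chip; have -> : (2 %| j - 1)%Z = ~~ (2 %| j)%Z by lia.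
    by rewrite jp; case: (p).
  have -> : S (j + 1) = S (j - 1) + chi j.
    by rewrite SS; have := SS (j - 1); rewrite subrK chi1 => ->; rewrite addr0.
  by rewrite rmorphD /=; field.
have -> : (~~ (2 %| j)%Z == p) by case: (p) jp; case: (2 %| j)%Z.
by rewrite chip // subrr mul0r mulr0.
Qed.

End SignPattern.

(** * Discrepancy of the liar machine *)

Section LiarMachine.

Lemma liar_step_support (f f' : int -> nat) (j : int) : liar_step f f' ->
  f' j <> 0%N -> f (j - 1) <> 0%N \/ f (j + 1) <> 0%N.
Proof.
move=> [chi chiP /(_ j) f'E] f'j.
case: (eqVneq (f (j - 1)) 0%N) => [f1|/eqP]; last by left.
case: (eqVneq (f (j + 1)) 0%N) => [f2|/eqP]; last by right.
by move: f'E; rewrite (chi_zero chiP f1) (chi_zero chiP f2) f1 f2; lia.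
Qed.

(** Provides the point from which the prefix sums of chi are counted; it moves
    left by one at each step. *)
Lemma liar_left_bounded (f : nat -> int -> nat) (t : nat) :
  starting_configuration (f 0%N) -> liar_evolution f ->
  exists L : int, forall j, j < L -> f t j = 0%N.
Proof.
move=> [fin _] fE; elim: t => [|t [L IHt]]; last first.
  exists (L - 1) => j jL; apply: contrapT => /(liar_step_support (fE t)).
  by case; apply; apply: IHt; lia.
have [s sE] := (finite_seqP _).1 fin.
have [L LP] : exists L : int, forall i, i \in s -> L <= i.
  elim: s {sE} => [|x s [L LP]]; first by exists 0.
  exists (Num.min x L) => i; rewrite inE => /orP[/eqP ->|/LP]; lia.
exists L => j; apply: contraTeq => /eqP fj.
have : j \in s by move: fj; rewrite -[_ <> _]/([set j | f 0%N j <> 0%N] j) sE.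
by move/LP; lia.
Qed.

Lemma liar_parity (f : nat -> int -> nat) (t : nat) :
  starting_configuration (f 0%N) -> liar_evolution f ->
  exists p : bool, forall j, f t j <> 0%N -> (2 %| j)%Z = p.
Proof.
move=> [_ par] fE; elim: t => [|t [p IHt]].
  by case: par => par; [exists true|exists false] => j /par[k _ <-]; lia.
exists (~~ p) => j /(liar_step_support (fE t)) [] /IHt; lia.
Qed.

Lemma liar_discrepancy (R : realType) (f : nat -> int -> nat)
    (g : nat -> int -> R) :
  starting_configuration (f 0%N) -> liar_evolution f -> linear_evolution g ->
  exists S : nat -> int -> R, (forall t j, `|S t j| <= 1) /\
    (forall t j, (f t.+1 j)%:R - g t.+1 j
      = avg (fun x => (f t x)%:R - g t x) j - 2 * cdiff (cdiff (S t)) j).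
Proof.
move=> f0 fE gE.
have /choice[S SP] : forall t, exists S : int -> R, (forall j, `|S j| <= 1) /\
    (forall j, (f t.+1 j)%:R - g t.+1 j
      = avg (fun x => (f t x)%:R - g t x) j - 2 * cdiff (cdiff S) j).
  move=> t; have [L fL] := liar_left_bounded t f0 fE.
  have [p fp] := liar_parity t f0 fE.
  have [chi chiP fE'] := fE t.
  have [S [S1 SE]] := chi_primitive R fL fp chiP.
  exists S; split=> // j; rewrite gE /avg.
  have := congr1 (intr : int -> R) (fE' j).
  rewrite !rmorphB !rmorphD rmorphM /= !SE /= => E.
  have -> : (f t.+1 j)%:R = (2 * (f t.+1 j)%:R) / 2 :> R by field.
  rewrite -!pmulrn in E; rewrite E {3}/cdiff.
  by field.
by exists S; split=> t; have [] := SP t.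
Qed.

Lemma config_sum_itv (R : realType) (h : int -> R) (a : int) (n : nat) :
  config_sum h `[a, a + n%:Z] = \sum_(i < n.+1) h (a + i%:Z).
Proof.
have inja : injective (fun i : nat => a + i%:Z) by move=> x y; lia.
(* An opaque m in place of n.+1 keeps [iota] from unfolding. *)
have [m mE] : exists m, m = n.+1 by exists n.+1.
rewrite -mE /config_sum (fsbigE [seq a + i%:Z | i <- iota 0 m]); last 3 first.
- by rewrite map_inj_uniq // iota_uniq.
- by move=> _ /= /mapP[i + ->]; rewrite mem_iota in_itv /=; lia.
- move=> i; rewrite /= in_itv /= => ai; apply: contraNeq => _.
  by apply/mapP; exists (absz (i - a)); rewrite ?mem_iota; lia.
have -> : iota 0 m = index_iota 0 m by rewrite /index_iota subn0.
rewrite big_map big_mkcond /= big_mkord.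
by apply: eq_bigr => i _; rewrite ifT // inE /= in_itv /=; have := ltn_ord i; lia.
Qed.

End LiarMachine.

Theorem theorem3 (R : realType) :
  exists c' : R,
    forall (a b : int) (f : nat -> int -> nat) (g : nat -> int -> R),
      a < b ->
      starting_configuration (f 0%N) ->
      (forall j : int, g 0%N j = (f 0%N j)%:R) ->
      liar_evolution f ->
      linear_evolution g ->
      forall t : nat,
        let B : R := (b - a)%:~R in
        `| config_sum (fun i => (f t i)%:R : R) `[a, b] - config_sum (g t) `[a, b] |
        <= c' * (if Num.sqrt (t%:R : R) / 2 < B
                 then Num.sqrt t%:R
                 else B * ln (t%:R / B ^+ 2)).
Proof.
(* 2 * 10 from [sum_two_regimes]; the regime of long intervals needs 2 * 4. *)
exists 20 => a b f g ab f0 g0 fE gE t /=; set B : R := (b - a)%:~R.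
pose n := absz (b - a).
have n_gt0 : (0 < n)%N by rewrite /n; lia.
have bE : b = a + n%:Z by rewrite /n; lia.
have BE : B = n%:R by rewrite /B bE addrAC subrr add0r.
have [S [S1 SE]] := liar_discrepancy f0 fE gE.
have dE j : (f t j)%:R - g t j
    = - 2 * \sum_(u < t) iter u avg (cdiff (cdiff (S (t - u.+1)%N))) j.
  apply: (@forced_walk R (fun s x => (f s x)%:R - g s x)) => // x.
  by rewrite g0 subrr.
(* Half the contribution, in absolute value, of the signs used u+1 steps ago. *)
pose e u := `|\sum_(i < n.+1)
  iter u avg (cdiff (cdiff (S (t - u.+1)%N))) (a + i%:Z)|.
have e_sqrt u : e u <= 2 / Num.sqrt u.+1%:R.
  by rewrite -[2]mulr1; exact: norm_sum_cdiff2_telescope.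
have e_inv u : e u <= 4 * n%:R / u.+1%:R.
  apply: le_trans (norm_sum_cdiff2_count _ _ _ (S1 _)) _.
  rewrite mulr1 mulrA ler_wpM2r ?invr_ge0 // -!natrM ler_nat; lia.
have err_le : `|config_sum (fun i => (f t i)%:R : R) `[a, b]
    - config_sum (g t) `[a, b]| <= 2 * \sum_(u < t) e u.
  rewrite bE !config_sum_itv -sumrB.
  under eq_bigr do rewrite dE.
  rewrite -mulr_sumr exchange_big normrM normrN normr_nat ler_wpM2l //.
  exact: ler_norm_sum.
apply: le_trans err_le _; rewrite BE; case: ifPn => [_|].
  have : \sum_(u < t) e u <= \sum_(u < t) 2 * (Num.sqrt u.+1%:R)^-1.
    by apply: ler_sum => u _.
  have := sum_invsqrt_le R t; rewrite -mulr_sumr.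
  have := sqrtr_ge0 (t%:R : R); lra.
rewrite -leNgt => le_nt.
have le_n2t : (4 * n ^ 2 <= t)%N.
  rewrite -(ler_nat R) natrM natrX -[t%:R]sqr_sqrtr //.
  have : 0 <= n%:R :> R by [].
  nra.
have := sum_two_regimes n_gt0 le_n2t e_sqrt e_inv; lra.
Qed.
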